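(* Let $N,k$ be positive integers with $N\ge 2k+1$, let $G$ be a connected $r$-regular graph on $m$ vertices, and let $X=C_N^k\square G$. Then $$\tau(X)=\frac{1}{Nm}\prod_{j=1}^{N-1}\kappa_j\prod_{\alpha=1}^{t}\prod_{j=0}^{N-1}\left(\kappa_j+\nu_\alpha\right)^{m_\alpha}.$$ Moreover, $$\tau(C_N^k\square G)=\frac{\tau(C_N^k)}{m}\prod_{\alpha=1}^{t}\prod_{j=0}^{N-1}\left(\kappa_j+\nu_\alpha\right)^{m_\alpha},$$ and $$\tau(C_N^k\square G)=\tau(C_N^k)\tau(G)\prod_{\alpha=1}^{t}\prod_{j=1}^{N-1}\left(\kappa_j+\nu_\alpha\right)^{m_\alpha}.$$
   Context: All graphs are finite, simple and undirected; $\mathbb Z_N=\mathbb Z/N\mathbb Z$. $C_N^k$ is the graph with vertex set $\mathbb Z_N$ in which $x,y$ are adjacent iff $x-y\equiv\pm s\pmod N$ for some $1\le s\le k$ (it is $2k$-regular since $N\ge 2k+1$). $X=C_N^k\square G$ is the Cartesian product: vertex set $\mathbb Z_N\times V(G)$, with $(x,a)$ and $(y,b)$ adjacent iff ($a=b$ and $x,y$ are adjacent in $C_N^k$) or ($x=y$ and $a,b$ are adjacent in $G$). $\tau(Y)$ is the number of spanning trees of a connected graph $Y$. $\theta_j=2\pi j/N$ and $\kappa_j=2k-2\sum_{s=1}^{k}\cos(s\theta_j)$. $L_G=rI_m-A_G$ is the Laplacian of $G$, with distinct eigenvalues $0=\nu_0<\nu_1<\cdots<\nu_t$; $m_\alpha$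 is the multiplicity of $\nu_\alpha$. *)

(* Defs.v *)
From mathcomp Require Import all_boot all_order all_algebra.
From mathcomp Require Import boolp reals trigo.

Set Implicit Arguments.
Unset Strict Implicit.
Unset Printing Implicit Defensive.

Import Order.TTheory GRing.Theory Num.Theory.

Local Open Scope ring_scope.

Section Graphs.
Variable T : finType.
Implicit Type e : rel T.

Definition simple_graph e : Prop := symmetric e /\ irreflexive e.

Definition connected_graph e : Prop :=
  (0 < #|T|)%N /\ forall x y : T, connect e x y.

Definition regular_graph (r : nat) e : Prop :=
  forall x : T, #|[set y | e x y]| = r.

(* The bound on the size excludes the sequences [:: x; y] that traverse a
   single edge back and forth, which satisfy ucycle. *)
Definition acyclic_graph e : Prop :=
  forall c : seq T, (2 < size c)%N -> ~ ucycle e c.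

Definition tree_graph e : Prop := connected_graph e /\ acyclic_graph e.

Definition edges e : {set {set T}} :=
  [set A | [exists x, exists y, e x y && (A == [set x; y])]].

Definition edge_adj (F : {set {set T}}) : rel T :=
  fun x y => [set x; y] \in F.

Definition num_spanning_trees e : nat :=
  #|[set F : {set {set T}} | (F \subset edges e) && `[< tree_graph (edge_adj F) >]]|.

End Graphs.

(* The power C_N^k of the cycle; 'Z_N is Z/NZ only for 1 < N. *)
Definition cycle_power (N k : nat) : rel 'Z_N :=
  fun x y => [exists s : 'I_k.+1,
    (0 < s)%N && ((x - y == (s : nat)%:R) || (x - y == - (s : nat)%:R))].

Definition cartesian_product (S T : finType) (e : rel S) (f : rel T) :
    rel (S * T) :=
  fun u v => ((u.2 == v.2) && e u.1 v.1) || ((u.1 == v.1) && f u.2 v.2).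

Section Spectrum.
Variable R : realType.

Definition adjacency_mx (T : finType) (e : rel T) : 'M[R]_#|T| :=
  \matrix_(i, j) (e (enum_val i) (enum_val j))%:R.

(* Laplacian of an r-regular graph. *)
Definition laplacian_mx (T : finType) (r : nat) (e : rel T) : 'M[R]_#|T| :=
  r%:R%:M - adjacency_mx e.

Definition eigen_multiplicity (n : nat) (A : 'M[R]_n) (x : R) : nat :=
  mup x (char_poly A).

(* nu 0 < ... < nu t are exactly the distinct eigenvalues of A; the values of
   nu beyond t are irrelevant. *)
Definition distinct_eigenvalues (n : nat) (A : 'M[R]_n) (t : nat)
    (nu : nat -> R) : Prop :=
  (forall a b : nat, (a < b <= t)%N -> nu a < nu b) /\
  (forall x : R, eigenvalue A x <-> exists2 a : nat, (a <= t)%N & x = nu a).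

Definition theta (N j : nat) : R := 2 * pi * j%:R / N%:R.

Definition kappa (N k j : nat) : R :=
  2 * k%:R - 2 * \sum_(1 <= s < k.+1) cos (s%:R * theta N j).

End Spectrum.

Arguments theta {R} N j.
Arguments kappa {R} N k j.

(* Main.v *)
Require Import Defs.
From mathcomp Require Import all_boot all_order all_algebra.
From mathcomp Require Import boolp reals trigo.
From mathcomp Require Import all_fingroup sesquilinear spectral complex.
From mathcomp Require Import zify ring lra.

(* Rooting spanning trees at a vertex rho identifies them with the maps f
   sending every vertex x <> rho to a neighbour such that the iterates of f lead
   from every vertex to rho.  Expanding row by row the determinant of the
   Laplacian with its row rho replaced by a unit vector gives a sum over all maps
   f, in which det(1 - f) is 1 if f is rooted and 0 otherwise: this is the
   matrix-tree theorem.  Factoring 'X out of the characteristic polynomial of the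
   Laplacian then shows that |T| * tau is the product of its eigenvalues, one
   eigenvalue 0 being omitted.  The Laplacian of C_N^k is diagonalized by the
   characters of Z/NZ, that of G by the spectral theorem, and that of the
   Cartesian product by products of eigenvectors, whose eigenvalues are sums.
   All three formulas follow, 0 being a simple eigenvalue of G because
   tau(G) <> 0. *)

Set Implicit Arguments.
Unset Strict Implicit.
Unset Printing Implicit Defensive.

Import Order.TTheory GRing.Theory Num.Theory.

Local Open Scope ring_scope.

(** * Spanning trees as rooted maps *)

Section RootedTrees.
Variables (T : finType) (root : T).

Lemma eq_set2 (x y z w : T) :
  [set x; y] = [set z; w] -> (x = z /\ y = w) \/ (x = w /\ y = z).
Proof.
move=> E.
have := set21 x y; have := set22 x y; rewrite E !inE.
have := set21 z w; have := set22 z w; rewrite -E !inE.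
do 4 ![case/orP=> /eqP ?]; subst; by [left | right].
Qed.

Definition rooted_map (f : T -> T) : bool :=
  (f root == root) && [forall x, fconnect f x root].

Definition depth (f : T -> T) (x : T) : nat := findex f x root.

(** Below [order f x] the iterates of [x] are distinct, so [findex] returns [n] itself; from there
    on [n] exceeds every index in the orbit. *)
Lemma depth_min (f : T -> T) x n : iter n f x = root -> (depth f x <= n)%N.
Proof.
move=> fn; have [lt_n|le_n] := ltnP n (fingraph.order f x).
  by rewrite /depth -fn findex_iter.
apply: leq_trans le_n; apply/ltnW/findex_max.
by rewrite -fn fconnect_iter.
Qed.

Lemma depth_parent (f : T -> T) x :
  rooted_map f -> x != root -> (depth f (f x) < depth f x)%N.
Proof.
case/andP=> _ /forallP/(_ x) fx xr.
have := iter_findex fx; rewrite -/(depth f x).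
case: (depth f x) => [|d]; first by move=> /= xE; rewrite xE eqxx in xr.
by rewrite iterSr ltnS; apply: depth_min.
Qed.

(** [root] is left out because a rooted map fixes it and would contribute the singleton
    [[set root]]. *)
Definition parent_edges (f : T -> T) : {set {set T}} :=
  [set [set x; f x] | x in [set~ root]].

Lemma parent_edgesE (f : T -> T) x y :
  edge_adj (parent_edges f) x y =
  (x != root) && (y == f x) || (y != root) && (x == f y).
Proof.
apply/imsetP/orP => [[z]|].
  rewrite !inE => zr /eq_set2[[-> ->]|[-> ->]]; rewrite zr eqxx; by [left|right].
case=> /andP[xr /eqP ->].
  by exists x => //; rewrite !inE.
by exists y; rewrite 1?setUC // !inE.
Qed.

Lemma edge_adj_sym (F : {set {set T}}) : symmetric (edge_adj F).
Proof. by move=> x y; rewrite /edge_adj setUC. Qed.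

Lemma parent_edges_connected (f : T -> T) :
  rooted_map f -> connected_graph (edge_adj (parent_edges f)).
Proof.
move=> rf; split; first by apply/card_gt0P; exists root.
have to_root x : connect (edge_adj (parent_edges f)) x root.
  have [n] := ubnP (depth f x); elim: n x => // n IHn x le_n.
  have [->|xr] := eqVneq x root; first exact: connect0.
  apply: (@connect_trans _ _ (f x)).
    by apply: connect1; rewrite parent_edgesE xr eqxx.
  by apply: IHn; apply: leq_trans (depth_parent rf xr) _.
move=> x y; apply: connect_trans (to_root x) _.
by rewrite (sym_connect_sym (@edge_adj_sym _)); apply: to_root.
Qed.

(* A vertex of maximal depth on a cycle would have two distinct parents. *)
Lemma parent_edges_acyclic (f : T -> T) :
  rooted_map f -> acyclic_graph (edge_adj (parent_edges f)).
Proof.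
move=> rf c sc /andP[cyc_c uc].
have [x xc x_max] : exists2 x, x \in c &
    forall y, y \in c -> (depth f y <= depth f x)%N.
  case: c sc {cyc_c uc} => // z c _.
  case: (@arg_maxnP _ z (fun y => y \in z :: c) (depth f)) => [|x]; last by exists x.
  exact: mem_head.
have up y : y \in c -> edge_adj (parent_edges f) x y -> y = f x.
  move=> yc; rewrite parent_edgesE => /orP[/andP[_ /eqP->]//|/andP[yr /eqP xE]].
  by have := depth_parent rf yr; rewrite -xE ltnNge x_max.
have [i s defc] := rot_to xc.
have in_c y : (y \in c) = (y \in x :: s) by rewrite -defc mem_rot.
move: cyc_c uc sc; rewrite -(rot_cycle i) -(rot_uniq i) -(size_rot i) defc.
case: s {defc} in_c => [|y s] // in_c /= /andP[exy].
rewrite rcons_path => /andP[_ ezx] /andP[_ /andP[ys _]] ss.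
have yE : y = f x by apply: up => //; rewrite in_c !inE eqxx orbT.
have zE : last y s = f x.
  by apply: up; rewrite 1?edge_adj_sym // in_c inE mem_last orbT.
case: s ss ys zE {ezx in_c} => // z s _ /=.
by rewrite yE => /negP ys zE; apply: ys; rewrite -zE mem_last.
Qed.

Lemma parent_edges_tree (f : T -> T) :
  rooted_map f -> tree_graph (edge_adj (parent_edges f)).
Proof.
by move=> rf; split; [apply: parent_edges_connected|apply: parent_edges_acyclic].
Qed.

(** Induction on depth: the edge from [x] to [f x] comes from [g] either as [g x = f x] or as
    [g (f x) = x]. In the second case the induction hypothesis at [f x] gives [f (f x) = x], against
    the strict decrease of depth along [f]. *)
Lemma parent_edges_inj (f g : T -> T) :
  rooted_map f -> rooted_map g -> parent_edges f = parent_edges g -> f =1 g.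
Proof.
move=> rf rg E x; have [n] := ubnP (depth f x); elim: n x => // n IHn x le_n.
have [/andP[/eqP fr _] /andP[/eqP gr _]] := (rf, rg).
have [->|xr] := eqVneq x root; first by rewrite fr gr.
have: edge_adj (parent_edges g) x (f x) by rewrite -E parent_edgesE xr eqxx.
rewrite parent_edgesE xr /= => /orP[/eqP//|/andP[fxr /eqP xE]].
have lt1 := depth_parent rf xr; have lt2 := depth_parent rf fxr.
move: xE; rewrite -IHn; last exact: leq_trans lt1 _.
by move=> xE; move: lt2; rewrite -xE ltnNge (ltnW lt1).
Qed.

(** Each vertex other than [root] is sent to a neighbour strictly closer to [root], as measured by
    the least length [dist] of a [g]-path. *)
Lemma exists_rooted_map (g : rel T) :
  (forall x, connect g x root) ->
  exists2 f : {ffun T -> T}, rooted_map f & forall x, x != root -> g x (f x).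
Proof.
move=> cg.
pose P x n := [exists p : n.-tuple T, path g x p && (last x p == root)].
have exP x : exists n, P x n.
  have /connectP[p gp pr] := cg x.
  by exists (size p); apply/existsP; exists (in_tuple p); rewrite gp pr /=.
pose dist x := ex_minn (exP x).
have step x : x != root -> exists y, g x y && (dist y < dist x)%N.
  move=> xr; rewrite {2}/dist; case: ex_minnP => n /existsP[[p /= /eqP sp]].
  case: p sp => [|y p] /= sp; first by move=> /eqP xE; rewrite xE eqxx in xr.
  case/andP=> /andP[gxy gp] pr; exists y; rewrite gxy -sp ltnS /dist.
  case: ex_minnP => k _; apply; apply/existsP; exists (in_tuple p).
  by rewrite gp.
pose f := [ffun x => if x == root then root else
             odflt x [pick y | g x y && (dist y < dist x)%N]].
have fP x : x != root -> g x (f x) && (dist (f x) < dist x)%N.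
  move=> xr; rewrite ffunE (negPf xr); case: pickP => //= no.
  by have [y] := step x xr; rewrite no.
exists f; last by move=> x /fP/andP[].
rewrite /rooted_map ffunE !eqxx /=; apply/forallP=> x.
have [n] := ubnP (dist x); elim: n x => // n IHn x le_n.
have [->|xr] := eqVneq x root; first exact: connect0.
have /andP[_ lt_d] := fP x xr.
by apply: connect_trans (fconnect1 f x) (IHn _ (leq_trans lt_d _)).
Qed.

(* An edge outside a spanning subtree closes a cycle with the tree path
   joining its end points. *)
Lemma tree_parent_edges (F : {set {set T}}) (f : T -> T) :
  acyclic_graph (edge_adj F) -> rooted_map f -> parent_edges f \subset F ->
  forall x y, x != y -> edge_adj F x y -> edge_adj (parent_edges f) x y.
Proof.
move=> acF rf sfF x y xy Fxy; apply/negPn/negP => nxy.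
have [_ /(_ x y)] := parent_edges_connected rf.
case/connectP=> p0 gp0 yE; rewrite yE in nxy Fxy xy.
case/shortenP: gp0 nxy Fxy xy {yE} => p gp up _ nxy Fxy xy.
have sFF : subrel (edge_adj (parent_edges f)) (edge_adj F).
  by move=> u v; apply: (subsetP sfF).
apply: (acF (x :: p)); last first.
  by rewrite /ucycle up /= rcons_path (sub_path sFF gp) edge_adj_sym Fxy.
(* A cycle needs three vertices: an empty path would mean [x = y], and a path of one step would put
   the edge into [parent_edges f]. *)
case: p gp up nxy Fxy xy => [|z [|w p]] //=; first by rewrite eqxx.
by rewrite andbT => ->.
Qed.

(** [parent_edges] is a bijection from the rooted maps along [e] onto the spanning trees: sending
    each vertex of a tree towards [root] gives a preimage, whose edges exhaust the tree by
    [tree_parent_edges]. *)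
Lemma num_spanning_treesE (e : rel T) : simple_graph e ->
  num_spanning_trees e =
  #|[set f : {ffun T -> T} |
      rooted_map f && [forall x, (x != root) ==> e x (f x)]]|.
Proof.
case=> e_sym e_irr.
pose tree_of (f : {ffun T -> T}) := parent_edges f.
rewrite /num_spanning_trees -(card_in_imset (f := tree_of)).
  congr #|pred_of_set _|; apply/setP=> F; rewrite inE.
  apply/andP/imsetP => [[Fe /asboolP[conF acF]]|[f]].
    have [f rf fF] := @exists_rooted_map (edge_adj F) (fun x => conF.2 x root).
    have sfF : parent_edges f \subset F.
      by apply/subsetP=> A /imsetP[x]; rewrite !inE => xr ->; apply: fF.
    exists f.
      rewrite inE rf; apply/forallP=> x; apply/implyP=> xr.
      have /(subsetP Fe) := fF x xr; rewrite inE.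
      case/existsP=> u /existsP[v /andP[euv /eqP /eq_set2 E]].
      by case: E => -[-> ->] //; rewrite e_sym.
    apply/eqP; rewrite eqEsubset sfF andbT; apply/subsetP=> A AF.
    have := subsetP Fe A AF; rewrite inE.
    case/existsP=> u /existsP[v /andP[euv /eqP AE]]; rewrite AE in AF *.
    apply: (tree_parent_edges acF rf sfF) => //.
    by apply: contraTneq euv => ->; rewrite e_irr.
  rewrite inE => /andP[rf /forallP fe] ->; split; last first.
    by apply/asboolP/parent_edges_tree.
  apply/subsetP=> A /imsetP[x]; rewrite !inE => xr ->.
  apply/existsP; exists x; apply/existsP; exists (f x).
  by rewrite eqxx andbT (implyP (fe x)).
move=> f g; rewrite !inE => /andP[rf _] /andP[rg _] E.
by apply/ffunP; apply: parent_edges_inj.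
Qed.

End RootedTrees.

Lemma num_spanning_trees_gt0 (T : finType) (e : rel T) :
  simple_graph e -> connected_graph e -> (0 < num_spanning_trees e)%N.
Proof.
move=> se [/card_gt0P[root _] ce]; rewrite (num_spanning_treesE root se).
have [f rf fe] := exists_rooted_map (fun x => ce x root).
by apply/card_gt0P; exists f; rewrite inE rf; apply/forallP=> x; apply/implyP/fe.
Qed.

(** * The matrix-tree theorem *)

Lemma sum_delta (F : pzRingType) (I : finType) (i : I) (g : I -> F) :
  \sum_j (i == j)%:R * g j = g i.
Proof.
rewrite (bigD1 i) //= eqxx mul1r big1 ?addr0 // => j.
by rewrite eq_sym => /negPf ->; rewrite mul0r.
Qed.

Lemma sum_deltaC (F : pzRingType) (I : finType) (i : I) (g : I -> F) :
  \sum_j (j == i)%:R * g j = g i.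
Proof. by rewrite -[RHS]sum_delta; apply: eq_bigr => j _; rewrite eq_sym. Qed.

Section RootedDeterminant.
Variables (F : comNzRingType) (n : nat).

(** Multiplying by the adjugate turns [A *m u = 0] into [\det A *: u = 0]. Since [F] may have zero
    divisors, a coordinate equal to 1 is asked for rather than a nonzero one. *)
Lemma det0_ker (A : 'M[F]_n) (u : 'cV_n) i : A *m u = 0 -> u i 0 = 1 -> \det A = 0.
Proof.
move=> Au0 ui; have /matrixP/(_ i 0) : \adj A *m (A *m u) = 0 by rewrite Au0 mulmx0.
by rewrite mulmxA mul_adj_mx mul_scalar_mx !mxE ui mulr1.
Qed.

Variable root : 'I_n.

Definition rooted_mx (f : 'I_n -> 'I_n) : 'M[F]_n :=
  \matrix_(i, j) if i == root then (j == root)%:R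
                 else (i == j)%:R - (f i == j)%:R.

Lemma det_rooted_mx (f : 'I_n -> 'I_n) :
  f root = root -> \det (rooted_mx f) = (rooted_map root f)%:R.
Proof.
move=> fr; have [rf|] := boolP (rooted_map root f); last first.
  rewrite /rooted_map fr eqxx /= => /forallPn[x nx].
  (* the indicator of the vertices that never reach the root *)
  apply: (@det0_ker _ (\col_i (~~ fconnect f i root)%:R) x); last by rewrite mxE nx.
  apply/colP=> i; rewrite !mxE; under eq_bigr do rewrite !mxE.
  have [ir|ir] := eqVneq i root.
    by rewrite sum_deltaC connect0.
  under eq_bigr do rewrite mulrBl.
  rewrite sumrB !sum_delta.
  suff -> : fconnect f i root = fconnect f (f i) root by rewrite subrr.
  apply/idP/idP => [fi|]; last exact/connect_trans/fconnect1.
  have := iter_findex fi; case: (findex f i root) => [/= iE|k].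
    by rewrite iE eqxx in ir.
  by rewrite iterSr => <-; apply: fconnect_iter.
have fx i : i != root -> (f i == i) = false.
  by move=> /(depth_parent rf); apply: contraTF => /eqP ->; rewrite ltnn.
rewrite /determinant (bigD1 1%g) //= odd_perm1 mul1r.
rewrite [X in X + _]big1 => [|i _]; last first.
  rewrite mxE perm1; have [_|ir] := eqVneq i root; first by [].
  by rewrite eqxx fx // subr0.
rewrite big1 ?addr0 // => s s1.
suff [i /eqP mi] : exists i, rooted_mx f i (s i) == 0.
  by rewrite (bigD1 i) //= mi mul0r mulr0.
apply/existsP; apply: contraT => /existsPn s_n0.
have [] := negP s1; apply/eqP/permP => i; rewrite perm1.
(* All factors of the term of [s] being nonzero, [s] fixes [root] and [s i] is [i] or [f i]
   elsewhere. By induction on depth [s] fixes [f i], so [s i = f i] would force [f i = i]. *)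
have [m] := ubnP (depth root f i); elim: m i => // m IHm i le_m.
have := s_n0 i; rewrite mxE; have [->|ir] := eqVneq i root.
  by have [//|_] := eqVneq (s root) root; rewrite eqxx.
have [//|_] := eqVneq i (s i); have [fsi|_] := eqVneq (f i) (s i); last first.
  by rewrite subrr eqxx.
move=> _; have /perm_inj fi : s (f i) = s i.
  by rewrite -fsi IHm // (leq_trans (depth_parent rf ir)).
by have := fx i ir; rewrite fi eqxx.
Qed.

(** Row [i] is the combination, with weights [w i l], of the rows that [rooted_mx f] has when
    [f i = l]. Multilinearity gives a sum over all maps [f], of which [det_rooted_mx] keeps the
    rooted ones. *)
Lemma det_laplacian_rooted (w : 'I_n -> 'I_n -> F) :
  \det (\matrix_(i, j) if i == root then (j == root)%:R
        else \sum_l w i l * ((i == j)%:R - (l == j)%:R)) =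
  \sum_(f : {ffun 'I_n -> 'I_n} | rooted_map root f)
    \prod_(i | i != root) w i (f i).
Proof.
(* At the row [root] the weight is concentrated on [f root = root], so that maps moving the root
   drop out. *)
pose w' i l := if i == root then (l == root)%:R else w i l.
pose m i l j : F := if i == root then (j == root)%:R else (i == j)%:R - (l == j)%:R.
transitivity (\sum_(f : {ffun 'I_n -> 'I_n})
   (\prod_i w' i (f i)) * \det (rooted_mx f)).
  have E (s : 'S_n) : \prod_i (\matrix_(i, j) if i == root then (j == root)%:R
        else \sum_l w i l * ((i == j)%:R - (l == j)%:R)) i (s i) =
     \sum_(f : {ffun 'I_n -> 'I_n}) \prod_i (w' i (f i) * m i (f i) (s i)).
    rewrite -(bigA_distr_bigA (fun i l => w' i l * m i l (s i))).
    apply: eq_bigr => i _; rewrite mxE /w' /m; case: eqP => // _.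
    by rewrite sum_deltaC.
  rewrite /determinant; under eq_bigr do rewrite E mulr_sumr.
  rewrite exchange_big /=; apply: eq_bigr => f _.
  rewrite mulr_sumr; apply: eq_bigr => s _.
  rewrite big_split /= mulrCA; congr (_ * (_ * _)).
  by apply: eq_bigr => i _; rewrite mxE.
rewrite [RHS]big_mkcond; apply: eq_bigr => f _.
have [fr|fr] := eqVneq (f root) root; last first.
  rewrite /rooted_map (negPf fr) /= (bigD1 root) //= {1}/w' eqxx (negPf fr).
  by rewrite !mul0r.
rewrite det_rooted_mx // (bigD1 root) //= {1}/w' fr !eqxx mul1r.
case: rooted_map; rewrite ?mulr0 ?mulr1 //.
by apply: eq_bigr => i /negPf ir; rewrite /w' ir.
Qed.

End RootedDeterminant.

Section MatrixTree.
Variables (F : comNzRingType) (T : finType) (e : rel T).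
Hypothesis e_simple : simple_graph e.

(** The graph Laplacian, each row spread over the neighbours [l] in the shape that
    [det_laplacian_rooted] expands. *)
Definition lap : 'M[F]_#|T| := \matrix_(i, j)
  \sum_l (e (enum_val i) (enum_val l))%:R * ((i == j)%:R - (l == j)%:R).

Lemma lap_mulcol m (g : 'M[F]_(#|T|, m)) i k :
  (lap *m g) i k = \sum_l (e (enum_val i) (enum_val l))%:R * (g i k - g l k).
Proof.
rewrite mxE; under eq_bigr do rewrite mxE mulr_suml.
rewrite exchange_big /=; apply: eq_bigr => l _.
under eq_bigr do rewrite -mulrA mulrBl.
by rewrite -mulr_sumr; congr (_ * _); rewrite sumrB !sum_delta.
Qed.

Lemma lap_sym : lap^T = lap.
Proof.
have [e_sym _] := e_simple.
apply/matrixP=> i j; rewrite !mxE; have [->//|ij] := eqVneq i j.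
rewrite (bigD1 i) //= [RHS](bigD1 j) //= !eqxx e_sym; congr (_ + _).
by rewrite !big1 // => l /negPf ->; rewrite ?(negPf ij) 1?eq_sym ?(negPf ij) subrr mulr0.
Qed.

Lemma lap_ker : lap *m const_mx 1 = 0 :> 'cV_#|T|.
Proof.
by apply/matrixP=> i j; rewrite lap_mulcol big1 ?mxE // => l _; rewrite !mxE subrr mulr0.
Qed.

Lemma fconnect_enum_val (f : 'I_#|T| -> 'I_#|T|) i j :
  fconnect (fun x => enum_val (f (enum_rank x))) (enum_val i) (enum_val j) =
  fconnect f i j.
Proof.
have itE k x : iter k (fun x => enum_val (f (enum_rank x))) (enum_val x) =
    enum_val (iter k f x) by elim: k => //= k ->; rewrite enum_valK.
apply/idP/idP=> /iter_findex; last by move=> <-; rewrite -itE fconnect_iter.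
by rewrite itE => /enum_val_inj <-; rewrite fconnect_iter.
Qed.

(** The cofactor is the determinant of [lap] with row [root] replaced by a unit vector. In its
    expansion the 0/1 weights keep exactly the rooted maps that follow edges. *)
Lemma matrix_tree (root : 'I_#|T|) : cofactor lap root root = (num_spanning_trees e)%:R.
Proof.
pose M : 'M[F]_#|T| := \matrix_(i, j) if i == root then (j == root)%:R
        else \sum_l (e (enum_val i) (enum_val l))%:R * ((i == j)%:R - (l == j)%:R).
have -> : cofactor lap root root = \det M.
  rewrite (expand_det_row M root); under eq_bigr do rewrite mxE eqxx.
  rewrite sum_deltaC; congr (_ * \det _); apply/matrixP=> i j.
  by rewrite !mxE [lift _ _ == root]eq_sym (negPf (neq_lift _ _)).
rewrite /M (det_laplacian_rooted root (fun i l => (e (enum_val i) (enum_val l))%:R)).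
rewrite (num_spanning_treesE (enum_val root) e_simple) -sum1_card natr_sum.
pose h (f : {ffun 'I_#|T| -> 'I_#|T|}) : {ffun T -> T} :=
  [ffun x => enum_val (f (enum_rank x))].
pose h' (f : {ffun T -> T}) : {ffun 'I_#|T| -> 'I_#|T|} :=
  [ffun i => enum_rank (f (enum_val i))].
have hK : cancel h h' by move=> f; apply/ffunP=> i; rewrite !ffunE !enum_valK.
have h'K : cancel h' h by move=> f; apply/ffunP=> i; rewrite !ffunE !enum_rankK.
rewrite (reindex h); last by apply: onW_bij; exists h'.
rewrite [RHS]big_mkcond [LHS]big_mkcond /=; apply: eq_bigr => f _; rewrite inE.
have -> : rooted_map (enum_val root) (h f) = rooted_map root f.
  rewrite /rooted_map ffunE enum_valK (inj_eq enum_val_inj); congr (_ && _).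
  apply/forallP/forallP => fr x.
    have := fr (enum_val x); rewrite -fconnect_enum_val.
    by rewrite (eq_fconnect (f' := h f)) // => y; rewrite ffunE.
  rewrite -(enum_rankK x) (eq_fconnect (f' := fun x => enum_val (f (enum_rank x)))).
    by rewrite fconnect_enum_val.
  by move=> y; rewrite ffunE.
case: rooted_map => //=; case: ifP => [/forallP fe|/forallPn[x]].
  rewrite big1 // => i ir; have := fe (enum_val i).
  by rewrite (inj_eq enum_val_inj) ir ffunE enum_valK /= => ->.
rewrite negb_imply ffunE => /andP[xr /negPf nex].
rewrite (bigD1 (enum_rank x)) /=; last by apply: contraNneq xr => <-; rewrite enum_rankK.
by rewrite enum_rankK nex mul0r.
Qed.

(** Let row [root] of [lap] be replaced by the difference of the unit vectors at [y] and [root]. All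
    row sums vanish, so the determinant is 0, and its expansion along that row is the difference of
    the two cofactors. *)
Lemma cofactor_lap_row (root y : 'I_#|T|) :
  cofactor lap root y = cofactor lap root root.
Proof.
pose M : 'M[F]_#|T| := \matrix_(i, j) if i == root then (j == y)%:R - (j == root)%:R
        else lap i j.
have cofE j : cofactor M root j = cofactor lap root j.
  congr (_ * \det _); apply/matrixP=> a b.
  by rewrite !mxE [lift _ _ == root]eq_sym (negPf (neq_lift _ _)).
have : \det M = 0.
  apply: (@det0_ker _ _ M (const_mx 1) root); last by rewrite mxE.
  apply/matrixP=> i j; have [->|ir] := eqVneq i root.
    rewrite !mxE; under eq_bigr do rewrite !mxE eqxx mulrBl.
    by rewrite sumrB !sum_deltaC subrr.
  have /matrixP/(_ i j) := lap_ker; rewrite !mxE => {2}<-.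
  by apply: eq_bigr => k _; rewrite mxE (negPf ir).
rewrite (expand_det_row M root); under eq_bigr do rewrite mxE eqxx cofE mulrBl.
rewrite sumrB !sum_deltaC.
by move/eqP; rewrite subr_eq0 => /eqP.
Qed.

(* The all-ones row vector u satisfies u *m P = 'X *: u for the characteristic
   matrix P of - lap; multiplying by \adj P exhibits the factor 'X. *)
Lemma matrix_tree_char_poly (q : {poly F}) : (0 < #|T|)%N ->
  char_poly (- lap) = 'X * q -> q.[0] = (#|T| * num_spanning_trees e)%:R.
Proof.
move=> T0; pose root := Ordinal T0; pose P := char_poly_mx (- lap).
rewrite mulrC => detP.
have : const_mx 1 *m P = 'X *: (const_mx 1 : 'rV_#|T|).
  rewrite mulmxBr mul_mx_scalar -[RHS]subr0; congr (_ - _).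
  rewrite map_mxN mulmxN -[const_mx 1]trmxK -[map_mx _ _]trmxK -trmx_mul.
  rewrite map_trmx lap_sym trmx_const -(map_const_mx polyC) -map_mxM lap_ker.
  by rewrite map_mx0 trmx0 oppr0.
move/(congr1 (fun A => (A *m \adj P) 0 root)).
rewrite -mulmxA mul_mx_adj -scalemxAl mul_mx_scalar !mxE mulr1 -/(char_poly _) detP.
(* Both sides are multiples of ['X]; comparing coefficients of degree 1 cancels it. *)
move/(congr1 (fun p : {poly F} => p`_1)).
rewrite coefMX coefXM /= -!horner_coef0 => ->.
(* Working with [- lap] avoids a sign here: its characteristic matrix at 0 is [lap] itself. *)
have P0 : map_mx (horner_eval 0) P = lap.
  apply/matrixP=> i j; rewrite !mxE /horner_eval !hornerE hornerMn !hornerE.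
  by rewrite mul0rn sub0r opprK.
rewrite horner_sum (eq_bigr (fun=> (num_spanning_trees e)%:R)) => [|y _].
  by rewrite sumr_const card_ord natrM mulr_natl.
rewrite !mxE mul1r -[LHS]/(horner_eval 0 _) -cofactor_map_mx P0.
by rewrite cofactor_lap_row matrix_tree.
Qed.

End MatrixTree.

(** * Laplacian eigenbases *)

Lemma char_poly_diagonalized (F : fieldType) n (A W U : 'M[F]_n) (d : 'rV_n) :
  U *m W = 1%:M -> A *m W = W *m diag_mx d ->
  char_poly A = \prod_i ('X - (d 0 i)%:P).
Proof.
move=> UW AW; set Q := \prod_i _.
have detQ : \det ('X%:M - map_mx polyC (diag_mx d)) = Q.
  have -> : 'X%:M - map_mx polyC (diag_mx d) = diag_mx (\row_i ('X - (d 0 i)%:P)).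
    apply/matrixP=> i j; rewrite !mxE; case: eqP => _; rewrite ?mulr1n //.
    by rewrite !mulr0n polyC0 subr0.
  by rewrite det_diag; apply: eq_bigr => i _; rewrite mxE.
have /(congr1 determinant) : char_poly_mx A *m map_mx polyC W =
    map_mx polyC W *m ('X%:M - map_mx polyC (diag_mx d)).
  by rewrite mulmxBl mulmxBr -!map_mxM AW mul_scalar_mx mul_mx_scalar.
rewrite !det_mulmx detQ mulrC; apply: mulfI.
have /(congr1 determinant) : map_mx polyC U *m map_mx polyC W = 1%:M.
  by rewrite -map_mxM UW map_mx1.
rewrite det_mulmx det1 => UW1; apply/eqP => W0.
by move/eqP: UW1; rewrite W0 mulr0 eq_sym oner_eq0.
Qed.

Lemma sum_enum_val (F : nmodType) (T : finType) (g : T -> F) :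
  \sum_(i < #|T|) g (enum_val i) = \sum_x g x.
Proof. by rewrite (big_enum_val (A := T)). Qed.

Lemma prod_enum_val (F : comNzRingType) (T : finType) (g : T -> F) :
  \prod_(i < #|T|) g (enum_val i) = \prod_x g x.
Proof. by rewrite (big_enum_val (A := T)). Qed.

Section Eigenbasis.
Variable F : fieldType.

(* The columns of [W] are the eigenvectors; its left inverse [U] makes them a
   basis. *)
Definition laplacian_eigenbasis (T : finType) (e : rel T)
    (W : T -> T -> F) (d : T -> F) : Prop :=
  (exists U : T -> T -> F, forall i j, \sum_x U i x * W x j = (i == j)%:R) /\
  (forall x i, \sum_y (e x y)%:R * (W x i - W y i) = d i * W x i).

(** The characteristic polynomial of [- lap] is the product of the ['X + (d i)%:P]; the factor at
    [i0] is ['X], and the others are evaluated at 0. *)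
Lemma num_spanning_trees_eigenbasis (T : finType) (e : rel T) W d i0 :
  simple_graph e -> laplacian_eigenbasis e W d -> d i0 = 0 ->
  (#|T| * num_spanning_trees e)%:R = \prod_(i | i != i0) d i.
Proof.
move=> se [[U UW] eW] di0.
have T0 : (0 < #|T|)%N by apply/card_gt0P; exists i0.
rewrite -(@matrix_tree_char_poly F _ _ se (\prod_(i | i != i0) ('X + (d i)%:P))) //.
  by rewrite horner_prod; apply: eq_bigr => i _; rewrite !hornerE.
pose mxT (g : T -> T -> F) : 'M_#|T| := \matrix_(i, j) g (enum_val i) (enum_val j).
rewrite (@char_poly_diagonalized F _ _ (mxT W) (mxT U) (\row_i - d (enum_val i))).
- under eq_bigr do rewrite mxE polyCN opprK.
  rewrite (prod_enum_val (fun x => 'X + (d x)%:P)) (bigD1 i0) //= di0.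
  by rewrite polyC0 addr0.
- apply/matrixP=> i j; rewrite !mxE; under eq_bigr do rewrite !mxE.
  by rewrite (sum_enum_val (fun x => U _ x * W x _)) UW (inj_eq enum_val_inj).
- rewrite mulNmx; apply/matrixP=> i j; rewrite mxE lap_mulcol.
  under eq_bigr do rewrite !mxE.
  rewrite (sum_enum_val (fun y => (e _ y)%:R * (W _ _ - W y _))) eW.
  rewrite mxE; under eq_bigr do rewrite !mxE mulrnAr mulrb.
  by rewrite -big_mkcond big_pred1_eq mulrN mulrC.
Qed.

Lemma cartesian_product_simple (S T : finType) (e : rel S) (f : rel T) :
  simple_graph e -> simple_graph f -> simple_graph (cartesian_product e f).
Proof.
move=> [es ei] [fs fi]; split=> [u v|u]; rewrite /cartesian_product.
  by rewrite es fs ![_ == v.1]eq_sym ![_ == v.2]eq_sym.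
by rewrite ei fi !andbF.
Qed.

Lemma cartesian_product_eigenbasis (S T : finType) (e : rel S) (f : rel T)
    W1 d1 W2 d2 :
  irreflexive e -> irreflexive f ->
  laplacian_eigenbasis e W1 d1 -> laplacian_eigenbasis f W2 d2 ->
  laplacian_eigenbasis (cartesian_product e f)
    (fun x i => W1 x.1 i.1 * W2 x.2 i.2) (fun i => d1 i.1 + d2 i.2).
Proof.
move=> ei fi [[U1 UW1] eW1] [[U2 UW2] eW2]; split.
  exists (fun i x => U1 i.1 x.1 * U2 i.2 x.2) => i j.
  rewrite -(pair_bigA _ (fun x y => U1 i.1 x * U2 i.2 y * (W1 x j.1 * W2 y j.2))) /=.
  under eq_bigr do under eq_bigr do rewrite mulrACA.
  under eq_bigr do rewrite -mulr_sumr UW2.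
  by rewrite -mulr_suml UW1 -natrM mulnb -pair_eqE.
case=> x y [i j] /=.
rewrite -(pair_bigA _ (fun a b => (cartesian_product e f (x, y) (a, b))%:R *
  (W1 x i * W2 y j - W1 a i * W2 b j))) /=.
(* The two disjuncts exclude each other: if [y = b], irreflexivity rules out [f y b]. Hence the
   indicator is a sum. *)
have E a b : (cartesian_product e f (x, y) (a, b))%:R =
    (y == b)%:R * (e x a)%:R + (x == a)%:R * (f y b)%:R :> F.
  rewrite /cartesian_product /=; have [->|_] := eqVneq y b.
    by rewrite fi andbF orbF mulr0 addr0 mul1r.
  by rewrite mul0r add0r -natrM mulnb.
under eq_bigr do under eq_bigr do rewrite E mulrDl -!mulrA.
under eq_bigr do rewrite big_split /= sum_delta -mulr_sumr.
rewrite big_split /= sum_delta mulrDl; congr (_ + _).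
  under eq_bigr do rewrite -mulrBl mulrA.
  by rewrite -mulr_suml eW1 mulrA.
under eq_bigr do rewrite -mulrBr mulrCA.
by rewrite -mulr_sumr eW2 mulrCA.
Qed.

End Eigenbasis.

(** * Spectral theorem for the Laplacian *)

Section RegularSpectrum.
Variables (R : realType) (V : finType) (e : rel V) (r : nat).
Hypotheses (e_simple : simple_graph e) (e_regular : regular_graph r e).

Lemma laplacian_mxE : laplacian_mx R r e = lap R e.
Proof.
apply/matrixP=> i j; rewrite !mxE; under eq_bigr do rewrite mulrBr.
rewrite sumrB -mulr_suml; congr (_ - _); last first.
  by under eq_bigr do rewrite mulrC; rewrite sum_deltaC.
rewrite (sum_enum_val (fun y => (e (enum_val i) y)%:R)) -natr_sum.
rewrite -(e_regular (enum_val i)) -sum1_card big_mkcond mulr_natr.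
by congr (_%:R *+ _); apply: eq_bigr => y _; rewrite inE; case: (e _ _).
Qed.

(** A real symmetric matrix is Hermitian, hence unitarily diagonalizable with real eigenvalues. The
    eigenvectors lie over [R[i]], as do the characters of Z/NZ, while the characteristic polynomial
    is factored over [R], where multiplicities are counted. *)
Lemma laplacian_real_spectrum : exists2 lambda : V -> R,
  char_poly (lap R e) = \prod_v ('X - (lambda v)%:P) &
  exists W, @laplacian_eigenbasis R[i] V e W (fun v => (lambda v)%:C%C).
Proof.
pose A := lap R[i] e.
have AE : A = map_mx (real_complex R) (lap R e).
  apply/matrixP=> i j; rewrite !mxE rmorph_sum; apply: eq_bigr => l _.
  by rewrite rmorphM rmorphB /= !rmorph_nat.
have A_herm : A \is hermsymmx.
  apply: realsym_hermsym.
    by apply/is_hermitianmxP; rewrite expr0 scale1r map_mx_id // lap_sym.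
  apply/mxOverP=> i j; rewrite AE mxE; apply/complex_realP; by eexists.
have /hermitian_normalmx/orthomx_spectralP := A_herm.
have /mxOverP d_real := hermitian_spectral_diag_real A_herm.
have := spectral_unit A.
move: (spectralmx A) (spectral_diag A) d_real => P d d_real Pu AP.
pose lambda v : R := complex.Re (d 0 (enum_rank v)).
have dE i : d 0 i = (lambda (enum_val i))%:C%C.
  by rewrite /lambda enum_valK RRe_real.
have APd : A *m invmx P = invmx P *m diag_mx d by rewrite {1}AP mulmxK.
exists lambda.
  apply: (map_poly_inj (real_complex R)); rewrite map_char_poly -AE.
  rewrite (char_poly_diagonalized (mulmxV Pu) APd) rmorph_prod /=.
  rewrite -(prod_enum_val (fun v => map_poly _ ('X - (lambda v)%:P))).
  by apply: eq_bigr => i _; rewrite dE map_polyXsubC.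
exists (fun x i => invmx P (enum_rank x) (enum_rank i)); split.
  exists (fun i x => P (enum_rank i) (enum_rank x)) => i j.
  have /matrixP/(_ (enum_rank i) (enum_rank j)) := mulmxV Pu.
  rewrite !mxE (inj_eq enum_rank_inj) => <-.
  rewrite -[LHS]sum_enum_val; apply: eq_bigr => k _; by rewrite enum_valK.
move=> x i; have /matrixP/(_ (enum_rank x) (enum_rank i)) := APd.
rewrite lap_mulcol mxE; under [RHS]eq_bigr do rewrite !mxE mulrnAr mulrb.
rewrite -big_mkcond big_pred1_eq dE !enum_rankK mulrC => <-.
rewrite -[LHS]sum_enum_val; apply: eq_bigr => k _.
by rewrite enum_valK.
Qed.

End RegularSpectrum.

(** * Powers of cycles *)

Section CyclePower.
Variables (N k : nat).
Hypothesis hN : (2 * k + 1 <= N)%N.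
Hypothesis k_gt0 : (0 < k)%N.

Let N_gt1 : (1 < N)%N. Proof. by lia. Qed.

Lemma Zp_nat_eq0 m : (m < N)%N -> (m%:R == 0 :> 'Z_N) = (m == 0%N).
Proof.
move=> m_lt; apply/eqP/eqP => [/(congr1 (fun x : 'Z_N => val x))|-> //].
by rewrite /= val_Zp_nat // modn_small.
Qed.

Lemma cycle_power_simple : simple_graph (@cycle_power N k).
Proof.
split=> [x y|x]; rewrite /cycle_power.
  apply: eq_existsb => s; rewrite -(opprB y x).
  by rewrite !eqr_oppLR opprK orbC.
apply/existsP=> -[s /andP[s0]]; rewrite subrr ![0 == _]eq_sym oppr_eq0 orbb.
rewrite Zp_nat_eq0; have := ltn_ord s; lia.
Qed.

(** The bound [2 * k + 1 <= N] makes the [2 * k] shifts by [s] and [- s] pairwise distinct, so each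
    neighbour is counted exactly once. *)
Lemma cycle_power_sum (F : pzRingType) (x : 'Z_N) (g : 'Z_N -> F) :
  \sum_y (cycle_power k x y)%:R * g y =
  \sum_(1 <= s < k.+1) (g (x - s%:R) + g (x + s%:R)).
Proof.
have inj s s' : (0 < s <= k)%N -> (0 < s' <= k)%N ->
    (s%:R == s'%:R :> 'Z_N) = (s == s').
  wlog le_s : s s' / (s <= s')%N => [IH hs hs'|hs hs'].
    by case: (leqP s s') => [|/ltnW] le; [|rewrite eq_sym [RHS]eq_sym]; exact: IH.
  by rewrite eq_sym -subr_eq0 -natrB // Zp_nat_eq0; apply/idP/idP; lia.
have neq_opp s s' : (0 < s <= k)%N -> (0 < s' <= k)%N ->
    (s%:R == - s'%:R :> 'Z_N) = false.
  by move=> hs hs'; rewrite -subr_eq0 opprK -natrD Zp_nat_eq0; lia.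
have E y : (cycle_power k x y)%:R = \sum_(1 <= s < k.+1)
    ((x - s%:R == y)%:R + (x + s%:R == y)%:R) :> F.
  have yE s : ((x - s%:R == y) = (x - y == s%:R)) * ((x + s%:R == y) = (x - y == - s%:R)).
    by split; rewrite ![x - y == _]subr_eq ![_ + y]addrC ?opprK;
       apply/eqP/eqP=> [<-|->]; ring.
  under eq_bigr do rewrite !yE.
  have [/existsP[s /andP[s0 xy]]|/existsPn no] := boolP (cycle_power k x y).
    have hs : (0 < s <= k)%N by rewrite s0 -ltnS ltn_ord.
    rewrite (bigD1_seq (s : nat)) ?mem_index_iota ?iota_uniq ?s0 ?ltn_ord //=.
    rewrite big_seq_cond big1 ?addr0.
      by case/orP: xy => /eqP ->; rewrite ?eqxx ?neq_opp 1?eq_sym ?neq_opp ?addr0 ?add0r.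
    move=> s'; rewrite mem_index_iota => /andP[hs' ss'].
    have {ss'} ns : (val s == s') = false by rewrite eq_sym; apply/negbTE.
    by case/orP: xy => /eqP ->; rewrite ?(inj_eq oppr_inj) inj // ns
      ?[- _ == _]eq_sym neq_opp ?addr0.
  rewrite big_seq big1 // => s; rewrite mem_index_iota => /andP[s0 sk].
  have := no (Ordinal sk); rewrite /= s0 /= negb_or => /andP[/negPf -> /negPf ->].
  by rewrite addr0.
under eq_bigr do rewrite E mulr_suml.
rewrite exchange_big /=; apply: eq_bigr => s _.
by under eq_bigr do rewrite mulrDl; rewrite big_split /= !sum_delta.
Qed.

End CyclePower.

(** * Characters of Z/NZ *)

Section Characters.
Variable R : realType.

(** The complex exponential $e^{it}$. *)
Definition cis (t : R) : R[i] := (cos t +i* sin t)%C.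

Lemma cisD s t : cis (s + t) = cis s * cis t.
Proof. by rewrite /cis cosD sinD; simpc; congr Complex; ring. Qed.

Lemma cis0 : cis 0 = 1.
Proof. by rewrite /cis cos0 sin0. Qed.

Lemma cisM n t : cis (n%:R * t) = cis t ^+ n.
Proof.
elim: n => [|n IHn]; first by rewrite mul0r cis0.
by rewrite -addn1 natrD mulrDl mul1r cisD IHn exprD expr1.
Qed.

Lemma cisDN t : cis t + cis (- t) = (2 * cos t)%:C%C.
Proof. by rewrite /cis cosN sinN; simpc; congr Complex; ring. Qed.

Lemma cis_theta_neq1 N m : (0 < m < N)%N -> cis (theta N m) != 1.
Proof.
move=> /andP[m0 mN]; have N0 : 0 < N%:R :> R by rewrite ltr0n (leq_ltn_trans _ mN).
(* Half the angle: [t] lies strictly between 0 and [pi], so [sin t] is positive, whereas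
   [cos (t *+ 2) = 1] would make it vanish. *)
pose t : R := pi * m%:R / N%:R.
have -> : theta N m = t *+ 2 by rewrite /theta /t mulr2n; ring.
have st : 0 < sin t.
  apply: sin_gt0_pi; rewrite /t divr_gt0 ?mulr_gt0 ?pi_gt0 //= ?ltr0n //.
  by rewrite ltr_pdivrMr // ltr_pM2l ?pi_gt0 // ltr_nat.
apply/negP=> /eqP cis1; have : cos (t *+ 2) = 1.
  exact: (congr1 (@complex.Re R) cis1).
rewrite cos_mulr2n cos2sin2; have := exprn_gt0 2 st; lra.
Qed.

Variables (N k : nat).
Hypothesis hN : (2 * k + 1 <= N)%N.
Hypothesis k_gt0 : (0 < k)%N.

Let N_gt1 : (1 < N)%N. Proof. by lia. Qed.

Lemma cis_thetaX j : cis (theta N j) ^+ N = 1.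
Proof.
rewrite -cisM /theta mulrC divfK ?pnatr_eq0; last by lia.
have -> : 2 * pi * j%:R = j%:R * (pi *+ 2) :> R by rewrite mulr2n; ring.
by rewrite cisM /cis cos2pi sin2pi expr1n.
Qed.

(** Addition in ['Z_N] reduces the exponent modulo [N], which is harmless because the base is an
    [N]-th root of unity. *)
Lemma cis_theta_ZpD j (x y : 'Z_N) :
  cis (theta N j) ^+ (x + y)%R = cis (theta N j) ^+ x * cis (theta N j) ^+ y.
Proof.
rewrite -exprD -(expr_mod (x + y) (cis_thetaX j)); congr (_ ^+ _).
by congr (_ %% _)%N; apply: Zp_cast.
Qed.

Lemma cis_theta_Zp_nat j s :
  cis (theta N j) ^+ (s%:R : 'Z_N) = cis (s%:R * theta N j).
Proof. by rewrite val_Zp_nat // expr_mod ?cisM // cis_thetaX. Qed.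

(** The sum is geometric; for [i <> j] its ratio is an [N]-th root of unity other than 1. *)
Lemma cis_theta_orth (i j : 'Z_N) :
  \sum_(x : 'Z_N) (cis (theta N i) ^- x) * cis (theta N j) ^+ x =
  N%:R * (i == j)%:R.
Proof.
pose w l := cis (theta N l).
have w_neq0 l : w l != 0.
  apply/eqP=> w0; have := cis_thetaX l; rewrite -/(w l) w0 expr0n.
  by case: (N) N_gt1 => // n _ /eqP; rewrite eq_sym oner_eq0.
have -> : \sum_(x : 'Z_N) w i ^- x * w j ^+ x = \sum_(x < N) (w j / w i) ^+ x.
  rewrite -(big_mkord xpredT (fun x => (w j / w i) ^+ x)).
  rewrite -[X in index_iota _ X](Zp_cast N_gt1).
  by rewrite big_mkord; apply: eq_bigr => x _; rewrite expr_div_n mulrC.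
have [->|ij] := eqVneq i j.
  rewrite divff // mulr1; under eq_bigr do rewrite expr1n.
  by rewrite sumr_const card_ord.
have wij : w j / w i - 1 != 0.
  apply: contra_neq ij => /eqP; rewrite subr_eq0 -(inj_eq (mulIf (w_neq0 i))).
  rewrite divfK // mul1r => /eqP wji; apply/val_inj => /=.
  have lt l : ((l : 'Z_N) < N)%N by rewrite -[X in (_ < X)%N](Zp_cast N_gt1).
  (* With [i < j] the subtraction [j - i] in [nat] is exact, and equal powers would give
     [cis (theta N (j - i)) = 1]. *)
  wlog lt_ij : i j wji / (i < j)%N => [IH|].
    by have [?|?|//] := ltngtP (i : nat) j; [apply: IH|apply/esym/IH].
  have /cis_theta_neq1/negP[] : (0 < j - i < N)%N by have := lt j; lia.
  apply/eqP; apply: (mulIf (w_neq0 i)); rewrite mul1r -[RHS]wji -cisD; congr cis.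
  by rewrite /theta natrB 1?ltnW //; ring.
apply: (mulfI wij); rewrite -subrX1 expr_div_n !cis_thetaX.
by rewrite divr1 subrr !mulr0.
Qed.

Lemma cycle_power_eigenbasis : laplacian_eigenbasis (@cycle_power N k)
  (fun x j : 'Z_N => cis (theta N j) ^+ x)
  (fun j : 'Z_N => (kappa N k j)%:C%C).
Proof.
split.
  exists (fun i x : 'Z_N => N%:R^-1 * cis (theta N i) ^- x) => i j.
  under eq_bigr do rewrite -mulrA.
  by rewrite -mulr_sumr cis_theta_orth mulKf // pnatr_eq0; lia.
move=> x j; rewrite (cycle_power_sum hN k_gt0).
pose w := cis (theta N j).
(* The shifts by [s] and [- s] are paired, their two conjugate roots of unity adding up to a real
   cosine: this is the term of index [s] in [kappa]. *)
have E s : (w ^+ x - w ^+ (x - s%:R)%R) + (w ^+ x - w ^+ (x + s%:R)%R) =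
   (2 - 2 * cos (s%:R * theta N j))%:C%C * w ^+ x.
  rewrite !cis_theta_ZpD cis_theta_Zp_nat.
  have -> : w ^+ (- s%:R : 'Z_N)%R = cis (- (s%:R * theta N j)).
    apply: (mulIf (x := w ^+ (s%:R : 'Z_N))).
      by apply/eqP=> w0; have := oner_neq0 R[i];
         rewrite -cis0 -(subrr (s%:R * theta N j)) cisD -cis_theta_Zp_nat -/w w0 mul0r eqxx.
    by rewrite -cis_theta_ZpD addNr cis_theta_Zp_nat -cisD addNr cis0.
  by rewrite rmorphB /= -cisDN rmorph_nat; ring.
under eq_bigr do rewrite E.
rewrite -mulr_suml -rmorph_sum sumrB -mulr_sumr sumr_const_nat subn1 /=.
by rewrite /kappa mulr_natr.
Qed.

End Characters.

(** * Tree numbers as products of real eigenvalues, and the three formulas *)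

Lemma num_spanning_trees_spectrum (R : realType) (T : finType) (e : rel T) W
    (d : T -> R) i0 :
  simple_graph e -> laplacian_eigenbasis e W (fun i => (d i)%:C%C) -> d i0 = 0 ->
  #|T|%:R * (num_spanning_trees e)%:R = \prod_(i | i != i0) d i.
Proof.
move=> se eW di0; apply: (@complexI R).
rewrite rmorph_prod /= rmorphM /= !rmorph_nat -natrM.
by apply: (num_spanning_trees_eigenbasis se eW); rewrite /= di0.
Qed.

Lemma mup_prod_XsubC (F : fieldType) (I : finType) (a : I -> F) x :
  mup x (\prod_i ('X - (a i)%:P)) = #|[pred i | a i == x]|.
Proof.
rewrite -(big_map a xpredT (fun y => 'X - y%:P)) mu_prod_XsubC.
by rewrite count_map -sum1_count -sum1_card.
Qed.

Lemma prod_Zp (F : pzSemiRingType) N (g : nat -> F) : (1 < N)%N ->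
  \prod_(j : 'Z_N) g j = \prod_(0 <= j < N) g j.
Proof. by move=> N_gt1; rewrite -(big_mkord xpredT g) Zp_cast. Qed.

Lemma prod_Zp_neq0 (F : comNzRingType) N (g : nat -> F) : (1 < N)%N ->
  \prod_(j : 'Z_N | j != 0) g j = \prod_(1 <= j < N) g j.
Proof.
move=> N_gt1; pose h j := if j == 0%N then 1 else g j.
transitivity (\prod_(j : 'Z_N) h j).
  rewrite big_mkcond; apply: eq_bigr => j _.
  by rewrite /h -val_eqE; case: (val j == 0%N).
rewrite prod_Zp // big_ltn 1?ltnW // {1}/h eqxx mul1r !big_nat.
by apply: eq_bigr => -[].
Qed.

Lemma kappa0 (R : realType) N k : kappa N k 0 = 0 :> R.
Proof.
rewrite /kappa /theta; under eq_bigr do rewrite mulr0 mul0r mulr0 cos0.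
by rewrite sumr_const_nat subn1 /= subrr.
Qed.

Theorem proposition5p4 (R : realType) (N k : nat) (V : finType) (e : rel V)
    (r t : nat) (nu : nat -> R)
    (N_gt0 : (0 < N)%N) (k_gt0 : (0 < k)%N) (hN : (2 * k + 1 <= N)%N)
    (e_simple : simple_graph e) (e_connected : connected_graph e)
    (e_regular : regular_graph r e)
    (nu_eigenvalues : distinct_eigenvalues (laplacian_mx R r e) t nu)
    (nu0 : nu 0%N = 0) :
  let m := #|V| in
  let mult := fun a => eigen_multiplicity (laplacian_mx R r e) (nu a) in
  let C := @cycle_power N k in
  let X := cartesian_product C e in
  [/\ (num_spanning_trees X)%:R =
        1 / (N%:R * m%:R) * \prod_(1 <= j < N) kappa N k j *
        \prod_(1 <= a < t.+1) \prod_(0 <= j < N) (kappa N k j + nu a) ^+ mult a,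
      (num_spanning_trees X)%:R =
        (num_spanning_trees C)%:R / m%:R *
        \prod_(1 <= a < t.+1) \prod_(0 <= j < N) (kappa N k j + nu a) ^+ mult a
    & (num_spanning_trees X)%:R =
        (num_spanning_trees C)%:R * (num_spanning_trees e)%:R *
        \prod_(1 <= a < t.+1) \prod_(1 <= j < N) (kappa N k j + nu a) ^+ mult a].
Proof.
move=> m mult C X.
have N_gt1 : (1 < N)%N by lia.
have [nu_lt nu_eig] := nu_eigenvalues.
have lapE := laplacian_mxE R e_regular.
have [lambda charE [W eW]] := laplacian_real_spectrum R e_simple.
have eigE x : eigenvalue (laplacian_mx R r e) x = [exists v, lambda v == x].
  rewrite eigenvalue_root_char lapE charE -(big_map lambda xpredT (fun a => 'X - a%:P)).
  rewrite root_prod_XsubC; apply/mapP/existsP => [[v _ ->]|[v /eqP <-]]; exists v => //.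
have multE a : mult a = #|[pred v | lambda v == nu a]|.
  by rewrite /mult /eigen_multiplicity lapE charE mup_prod_XsubC.
have [v0 /eqP lv0] : exists v, lambda v == 0.
  by apply/existsP; rewrite -eigE nu_eig; exists 0%N.
have C_simple : simple_graph C by apply: cycle_power_simple.
have tauG := num_spanning_trees_spectrum e_simple eW lv0.
have eC := cycle_power_eigenbasis R hN k_gt0.
have tauC := num_spanning_trees_spectrum (i0 := 0) C_simple eC (kappa0 R N k).
have m_neq0 : m%:R != 0 :> R.
  by rewrite pnatr_eq0 -lt0n; case: e_connected.
have N_neq0 : N%:R != 0 :> R by rewrite pnatr_eq0 -lt0n.
have card_ZN : #|'Z_N| = N by rewrite card_ord Zp_cast.
(* A connected graph has a spanning tree, so [tauG] rules out a second zero
   eigenvalue. *)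
have lambda_neq0 v : v != v0 -> lambda v != 0.
  have : \prod_(v | v != v0) lambda v != 0.
    rewrite -tauG mulf_neq0 // pnatr_eq0 -lt0n.
    exact: num_spanning_trees_gt0.
  by move/prodf_neq0; apply.
have nu_inj a b : (a <= t)%N -> (b <= t)%N -> nu a = nu b -> a = b.
  move=> at_ bt E; case: (ltngtP a b) => // ab.
    by have := nu_lt a b; rewrite ab bt E ltxx => /(_ isT).
  by have := nu_lt b a; rewrite ab at_ E ltxx => /(_ isT).
have nu_neq0 a : (0 < a <= t)%N -> nu a != 0.
  by move=> /nu_lt; rewrite nu0 => /lt0r_neq0.
(* The eigenvalues are grouped by value. The index [a] starts at 1 because, by [lambda_neq0],
   leaving out [v0] removes exactly the value [nu 0 = 0]. *)
have group (H : R -> R) :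
    \prod_(v | v != v0) H (lambda v) = \prod_(1 <= a < t.+1) H (nu a) ^+ mult a.
  have exa v : exists a : 'I_t.+1, lambda v == nu a.
    have : eigenvalue (laplacian_mx R r e) (lambda v).
      by rewrite eigE; apply/existsP; exists v.
    by rewrite nu_eig => -[a le_a ->]; exists (Ordinal (n := t.+1) le_a).
  pose idx v := xchoose (exa v); have idxP v : lambda v = nu (idx v).
    exact/eqP/(xchooseP (exa v)).
  rewrite (partition_big idx (fun a : 'I_t.+1 => (0 < a)%N)); last first.
    move=> v /lambda_neq0; apply: contraNT; rewrite -leqNgt leqn0 => /eqP i0.
    by rewrite idxP i0 nu0.
  rewrite big_geq_mkord; apply: eq_bigr => a a_gt0.
  rewrite multE -prodr_const.
  apply: eq_big => [v|v /andP[_ /eqP <-]]; last by rewrite idxP.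
  rewrite inE; apply/andP/eqP => [[_ /eqP <-]|lva]; first exact: idxP.
  split; last first.
    by apply/eqP/val_inj/nu_inj; rewrite -1?ltnS ?ltn_ord // -idxP.
  apply: contraTneq (nu_neq0 a _) => [vE|]; first by rewrite -lva vE lv0 eqxx.
  by rewrite a_gt0 -ltnS ltn_ord.
have eX := cartesian_product_eigenbasis C_simple.2 e_simple.2 eC eW.
have X_simple : simple_graph X by apply: cartesian_product_simple.
have prodX j0 : \prod_(1 <= a < t.+1) \prod_(j0 <= j < N) (kappa N k j + nu a) ^+ mult a
   = \prod_(v | v != v0) \prod_(j0 <= j < N) (kappa N k j + lambda v).
  rewrite (group (fun x => \prod_(j0 <= j < N) (kappa N k j + x))).
  by under [RHS]eq_bigr do rewrite -prodrXl.
(* The pairs other than [(0, v0)] split into those with [v = v0], which give the [kappa] with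
   [j <> 0], and those with [v <> v0], where [j] is arbitrary. *)
have tauX : N%:R * m%:R * (num_spanning_trees X)%:R =
    \prod_(1 <= j < N) kappa N k j *
    \prod_(1 <= a < t.+1) \prod_(0 <= j < N) (kappa N k j + nu a) ^+ mult a.
  have {eX} eX : laplacian_eigenbasis X
      (fun x i : 'Z_N * V => cis (theta N i.1) ^+ x.1 * W x.2 i.2)
      (fun i => (kappa N k i.1 + lambda i.2)%:C%C).
    by case: eX => UW eX; split=> // x i; rewrite rmorphD; apply: eX.
  rewrite -natrM -{1}card_ZN -card_prod.
  rewrite (num_spanning_trees_spectrum (i0 := (0, v0)) X_simple eX) /=; last first.
    by rewrite kappa0 lv0 addr0.
  rewrite big_mkcond /=.
  rewrite -(pair_bigA _ (fun (j : 'Z_N) v => if (j, v) != (0, v0)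
    then kappa N k j + lambda v else 1)) exchange_big (bigD1 v0) //=.
  congr (_ * _).
    rewrite -(prod_Zp_neq0 (kappa N k)) // [RHS]big_mkcond; apply: eq_bigr => j _.
    by rewrite xpair_eqE eqxx andbT lv0 addr0.
  rewrite prodX; apply: eq_bigr => v vv0.
  rewrite -(prod_Zp (fun j => kappa N k j + lambda v)) //.
  by apply: eq_bigr => j _; rewrite xpair_eqE (negPf vv0) andbF.
have tauC' : N%:R * (num_spanning_trees C)%:R = \prod_(1 <= j < N) kappa N k j :> R.
  rewrite -(prod_Zp_neq0 (kappa N k)) // -tauC; congr (_%:R * _).
  exact/esym/card_ZN.
split.
- apply: (mulfI (mulf_neq0 N_neq0 m_neq0)).
  by rewrite tauX mul1r !mulrA mulfV ?mulf_neq0 // mul1r.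
- apply: (mulfI (mulf_neq0 N_neq0 m_neq0)); rewrite tauX -tauC'.
  by field.
- apply: (mulfI (mulf_neq0 N_neq0 m_neq0)); rewrite tauX -tauC' !prodX.
  (* The factors with [j = 0] are the nonzero eigenvalues of [e], whose product is [m] times its
     number of spanning trees by [tauG]. *)
  under eq_bigr do rewrite big_ltn // kappa0 add0r.
  rewrite big_split /= -tauG -/m; ring.
Qed.
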